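(* Let $k\ge 1$ and $n\ge k+1$. Let $$\mathbf F=\sum_{i=1}^l \mathbf F_i\,\mathcal H^{k-1}_{|[a_0^i,\dots,a_{k-1}^i]}$$ be a system of forces on $(k-1)$-simplices $s_i=[a_0^i,\dots,a_{k-1}^i]$ in $\mathbb{R}^n$, with $\mathbf F_i\in\mathbb{R}^n$, which satisfies the equilibrium condition $$\sum_{i=1}^l\mathbf F_i=0,\qquad \sum_{i=1}^l\mathbf F_i\wedge\hat s_i=0.$$ Then $\mathbf F$ can be decomposed into finitely many $k$-beams: there are finitely many $k$-simplices $\sigma_1,\dots,\sigma_N$ in $\mathbb{R}^n$ and symmetric $n\times n$ matrices (Cauchy stress tensors) $A_1,\dots,A_N$, with the eigenvectors of $A_j$ of nonzero eigenvalue in the tangent space of $\sigma_j$, such that $$\mathbf F=\sum_{j=1}^N A_j\otimes \mathrm{Beam}(\sigma_j).$$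
   Context: Force systems. $\mathcal H^{k-1}_{|s}$ is the $(k-1)$-dimensional Hausdorff measure in $\mathbb{R}^n$ restricted to the simplex $s$ (a Dirac mass when $k=1$). In a system $\sum_i\mathbf F_i\,\mathcal H^{k-1}_{|s_i}$, the vector $\mathbf F_i\in\mathbb{R}^n$ is the (constant) force exerted on the $(k-1)$-simplex $s_i=[a_0^i,\dots,a_{k-1}^i]$, and $\hat s_i=(a_0^i+\cdots+a_{k-1}^i)/k$ is the barycenter of $s_i$. Beams. Let $\sigma=[a_0,\dots,a_k]$ be a $k$-simplex in $\mathbb{R}^n$ with vertices ordered lexicographically, $a_0<\cdots<a_k$; its tangent space is $\mathrm{span}(a_1-a_0,\dots,a_k-a_0)$. Let $A=\sum_{j=1}^k\mu_j\,v_j\otimes v_j$ with $\mu_j\in\mathbb{R}$ and $v_1,\dots,v_k$ orthonormal vectors in the tangent space of $\sigma$, each chosen lexicographically positive ($v\otimes v$ is the matrix with $(p,q)$-entry $v_pv_q$). The $k$-beam $A\otimes\mathrm{Beam}(\sigma)$ is the system of boundary forces $$A\otimes\mathrm{Beam}(\sigma)=\frac{1}{\mathrm{vol}(\sigma)}\sum_{i=0}^k(-1)^i\sum_{j=1}^k\mu_jv_j\,\big[(\zeta\,\llcorner\, d\eta_i)\cdot v_j\big]\;d\mathcal H^{k-1}_{|[a_0,\dots,\widehat{a_i},\dots,a_k]},$$ where $\mathrm{vol}(\sigma)=\sqrt{\mathrm{Gram}(a_1-a_0,\dots,a_k-a_0)}$, $\zeta=(a_1-a_0)\wedge\cdots\wedge(a_k-a_0)$,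 $d\eta_i=d(a_1-a_0)\wedge\cdots\wedge\widehat{d(a_i-a_0)}\wedge\cdots\wedge d(a_k-a_0)$ for $i>0$, $d\eta_0=d(a_2-a_1)\wedge\cdots\wedge d(a_k-a_1)$, $d(w)$ is the covector dual to $w\in\mathbb{R}^n$, i.e. $x\mapsto w\cdot x$, a hat means omission, and $\zeta\,\llcorner\,d\eta\in\mathbb{R}^n$ is the left interior multiplication, defined by $d\beta(\zeta\,\llcorner\,d\eta)=(d\eta\wedge d\beta)(\zeta)$ for all $\beta\in\mathbb{R}^n$, with the determinant pairing of $k$-covectors and $k$-vectors. For $k=1$ the covectors $d\eta_i$ are empty products (equal to $1$), and the beams are the real multiples $\lambda\,\mathrm{Beam}([a,b])$ of $\mathrm{Beam}([a,b])=(\delta_b-\delta_a)\frac{b-a}{|b-a|}$. *)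

(* Defs.v *)
(* Vectors of R^n are row vectors. *)
From HB Require Import structures.
From mathcomp Require Import all_boot all_order all_algebra.
From mathcomp Require Import all_classical all_reals all_analysis.

Set Implicit Arguments.
Unset Strict Implicit.
Unset Printing Implicit Defensive.

Import Order.TTheory GRing.Theory Num.Theory.
Import numFieldNormedType.Exports.

Local Open Scope classical_set_scope.
Local Open Scope ring_scope.

Section Euclidean.
Context {R : realType} {n : nat}.
Implicit Types u v : 'rV[R]_n.

Definition dot u v : R := (u *m v^T) 0 0.

(* The norm that the library puts on ['rV[R]_n] is the sup norm. *)
Definition enorm u : R := Num.sqrt (dot u u).

Definition lexlt u v : Prop :=
  exists i : 'I_n, u 0 i < v 0 i /\ forall j : 'I_n, (j < i)%N -> u 0 j = v 0 j.

Definition tensor u v : 'M[R]_n := u^T *m v.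

(* The exterior square of R^n is identified with the skew-symmetric matrices. *)
Definition wedge2 u v : 'M[R]_n := tensor u v - tensor v u.

(* The topology of ['rV[R]_n] is the usual one. *)
Definition borel : set (set 'rV[R]_n) := <<s [set U | open U] >>.

End Euclidean.

Section Hausdorff.
Context {R : realType} {n : nat}.
Implicit Types (U E : set 'rV[R]_n) (d : nat).

(* Volume of the unit ball of R^d. *)
Fixpoint ball_volume d : R :=
  match d with
  | 0 => 1
  | 1 => 2
  | d'.+2 => 2 * pi / d%:R * ball_volume d'
  end.

Definition diam U : \bar R :=
  ereal_sup [set (enorm (x.1 - x.2))%:E | x in U `*` U].

(* For d = 0 a nonempty set has size 1, so that the measure below counts. *)
Definition hausdorff_size d U : \bar R :=
  if pselect (U = set0) then 0%E
  else ((ball_volume d / 2 ^+ d)%:E * diam U ^+ d)%E.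

Definition hausdorff_pre d (delta : R) E : \bar R :=
  ereal_inf [set (\sum_(0 <= i <oo) hausdorff_size d (U i))%E |
    U in [set U : nat -> set 'rV[R]_n |
           E `<=` \bigcup_i U i /\ forall i, (diam (U i) <= delta%:E)%E]].

Definition hausdorff d E : \bar R :=
  ereal_sup [set hausdorff_pre d delta E | delta in [set delta : R | 0 < delta]].

End Hausdorff.

Section Simplices.
Context {R : realType} {n : nat}.

(* Vertices of a d-simplex. *)
Definition vertices d := 'I_d.+1 -> 'rV[R]_n.

Definition is_simplex d (a : vertices d) : Prop :=
  forall c : 'I_d.+1 -> R,
    \sum_i c i = 0 -> \sum_i c i *: a i = 0 -> forall i, c i = 0.

Definition lex_ordered d (a : vertices d) : Prop :=
  forall i j : 'I_d.+1, (i < j)%N -> lexlt (a i) (a j).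

Definition hull d (a : vertices d) : set 'rV[R]_n :=
  [set x | exists t : 'I_d.+1 -> R,
     [/\ forall i, 0 <= t i, \sum_i t i = 1 & x = \sum_i t i *: a i]].

Definition barycenter d (a : vertices d) : 'rV[R]_n :=
  d.+1%:R^-1 *: \sum_i a i.

(* Row j is a_(j+1) - a_0; the row space is the tangent space. *)
Definition edges d (a : vertices d) : 'M[R]_(d, n) :=
  \matrix_(j < d) (a (lift ord0 j) - a ord0).

(* [a_0, ..., ^a_i, ..., a_k], meant for 0 < k: then bump i j <= k. *)
Definition face k (a : vertices k) (i : 'I_k.+1) : vertices k.-1 :=
  fun j => a (inord (bump i j)).

(* Restriction of the d-dimensional Hausdorff measure to a d-simplex; this is
   a finite measure, hence the real values. *)
Definition hausdorff_on d (a : vertices d) (B : set 'rV[R]_n) : R :=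
  fine (hausdorff d (B `&` hull a)).

(* The R^n-valued measure \sum_i F_i H^d restricted to s_i. *)
Definition force_system d (l : nat) (F : 'I_l -> 'rV[R]_n)
    (s : 'I_l -> vertices d) (B : set 'rV[R]_n) : 'rV[R]_n :=
  \sum_(i < l) hausdorff_on (s i) B *: F i.

End Simplices.

Arguments vertices R n d : clear implicits.

Section Beams.
Context {R : realType} {n k : nat}.

(* A simple k-vector, or k-covector, is given by its factors, as rows. *)
Definition pairing (w z : 'M[R]_(k, n)) : R := \det (w *m z^T).

(* deta /\ d(beta), for 0 < k *)
Definition wedge_last (eta : 'M[R]_(k.-1, n)) (beta : 'rV[R]_n) : 'M[R]_(k, n) :=
  \matrix_(p < k) (if insub (val p) is Some q then row q eta else beta).

Definition interior_mul (zeta : 'M[R]_(k, n)) (eta : 'M[R]_(k.-1, n)) : 'rV[R]_n :=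
  \row_p pairing (wedge_last eta (delta_mx 0 p)) zeta.

Definition vol (a : vertices R n k) : R :=
  Num.sqrt (\det (edges a *m (edges a)^T)).

(* A = \sum_j mu_j v_j (x) v_j with the conditions imposed on the v_j *)
Definition stress_decomposition (a : vertices R n k) (A : 'M[R]_n)
    (mu : 'I_k -> R) (v : 'I_k -> 'rV[R]_n) : Prop :=
  [/\ forall i j, dot (v i) (v j) = (i == j)%:R,
      forall j, (v j <= edges a)%MS,
      forall j, lexlt 0 (v j) &
      A = \sum_j mu j *: tensor (v j) (v j)].

(* [edges (face a i)] lists the factors of deta_i, also for i = 0, since the
   first vertex of the face is a_0 for i > 0 and a_1 for i = 0. *)
Definition beam_force (a : vertices R n k) (mu : 'I_k -> R)
    (v : 'I_k -> 'rV[R]_n) (i : 'I_k.+1) : 'rV[R]_n :=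
  (vol a)^-1 *: ((-1) ^+ i *:
    \sum_j (mu j * dot (interior_mul (edges a) (edges (face a i))) (v j)) *: v j).

(* A (x) Beam(a), for A decomposed by mu and v *)
Definition beam (a : vertices R n k) (mu : 'I_k -> R) (v : 'I_k -> 'rV[R]_n) :
    set 'rV[R]_n -> 'rV[R]_n :=
  force_system (beam_force a mu v) (face a).

End Beams.

(* The defining property of the interior multiplication. *)
Lemma dot_interior_mul {R : realType} {n k : nat} (zeta : 'M[R]_(k, n))
    (eta : 'M[R]_(k.-1, n)) (beta : 'rV[R]_n) : (0 < k)%N ->
  dot beta (interior_mul zeta eta) = pairing (wedge_last eta beta) zeta.
Proof.
case: k zeta eta => // k zeta eta _.
pose c q := cofactor (wedge_last (k := k.+1) eta 0 *m zeta^T) ord_max q.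
have E (b : 'rV[R]_n) : pairing (wedge_last (k := k.+1) eta b) zeta =
    \sum_q dot b (row q zeta) * c q.
  rewrite /pairing (expand_det_row _ ord_max); apply: eq_bigr => q _.
  congr (_ * _).
    rewrite /dot !mxE; apply: eq_bigr => p _; rewrite !mxE /=.
    by rewrite insubN ?ltnn.
  rewrite /c /cofactor; congr (_ * \det _); apply/matrixP => i j.
  rewrite !mxE; apply: eq_bigr => p _; rewrite !mxE /=.
  have lt_ik : (i < k)%N := ltn_ord i.
  have lt_i : (bump k i < k)%N by rewrite /bump (leqNgt k i) lt_ik.
  by rewrite (insubT (fun x => x < k)%N lt_i).
rewrite E {1}/dot mxE.
under eq_bigr => p _ do rewrite !mxE E mulr_sumr.
rewrite exchange_big; apply: eq_bigr => q _ /=.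
rewrite {2}/dot mxE mulr_suml; apply: eq_bigr => p _.
rewrite mulrA; congr (_ * _ * _).
rewrite /dot -rowE !mxE //.
Qed.

(* Main.v *)
Require Import Defs.
From HB Require Import structures.
From mathcomp Require Import all_boot all_order all_algebra.
From mathcomp Require Import all_classical all_reals all_analysis.
From mathcomp Require Import perm ring_quotient zify ring.

Set Implicit Arguments.
Unset Strict Implicit.
Unset Printing Implicit Defensive.

Import Order.TTheory GRing.Theory Num.Theory.
Import numFieldNormedType.Exports.

Local Open Scope ring_scope.

(** The beam on a simplex sigma whose stress has rank one, along an edge
a_p - a_q, exerts the force c (a_p - a_q) on the face opposite a_p, the
opposite force on the face opposite a_q, and nothing on the other faces: the
area covectors of the faces are, up to a common factor, the differentials of
the barycentric coordinates, and only those of a_p and a_q change along the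
edge ([beam_two_faces]).  So, modulo sums of beams, the load
(s, F) -- the force F on the simplex s -- obeys the rule

  (a :: t, c (b - a)) = (b :: t, c (b - a))        (a, b, t independent):

a vertex of s may slide along the line of action of the force.

It remains to derive from this rule that every system in equilibrium vanishes
modulo beams.  This is pure algebra ([balanced_sum_eq0]): the class of (s, F)
only depends on F and on the barycenter of s, through an offset additive in F
and a skew form applied to the barycenter and F.  Moving one vertex from a to b
changes the class by [move t a b], an additive function of F.  By the sliding
rule it vanishes when F is along b - a, so that it is skew in the displacement
b - a and in F.  A second difference, in two of the vertices, is symmetric in
its two displacements, and skew in F and either displacement; a trilinear
expression that is symmetric in one pair of arguments and skew in another is
zero ([diff2_eq0]).  Hence the class is an affine function of each vertex, whose
slope does not depend on the other vertices; it is a sum over the vertices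
([f_slope]), and skewness turns the sum into a form ([slope_form]).  Equilibrium
of forces kills the offset, and equilibrium of torques makes the tensor on which
the form is evaluated symmetric, so that the form gives zero ([form_sym_eq0]).

The sliding rule requires affinely independent vertices.  This is why the
argument takes place on auxiliary points in general position, chosen on the
moment curve ([moment_avoids]).  The given simplices are then reached by
replacing their vertices by auxiliary points one at a time ([f_mixed]).

Only one property of the Hausdorff measures enters: two simplices with the same
vertices carry the same measure. *)

(** * General position *)

Section GeneralPosition.
Context {R : numFieldType} {n : nat}.
Implicit Types (p x : 'rV[R]_n) (s t xs S : seq 'rV[R]_n).

(** Affine independence of points is linear independence of their lifts to the
affine hyperplane of height 1. *)
Definition homog p : 'rV[R]_(1 + n) := row_mx 1 p.

Definition indep s := free (map homog s).

Lemma indep_perm s t : perm_eq s t -> indep s = indep t.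
Proof. by move=> st; apply: perm_free; apply: perm_map. Qed.

Lemma indep_cons x s :
  indep (x :: s) = (homog x \notin <<map homog s>>%VS) && indep s.
Proof. exact: free_cons. Qed.

Lemma homog_inj : injective homog.
Proof. by move=> p q /eq_row_mx []. Qed.

Lemma indep1 p : indep [:: p].
Proof.
rewrite /indep seq1_free; apply/eqP => h.
have /(congr1 (fun w : 'rV[R]_(1 + n) => w 0 (lshift n 0))) := h.
by rewrite row_mxEl !mxE eqxx => /eqP; rewrite oner_eq0.
Qed.

Lemma homog_lincomb (I : Type) (r : seq I) (c : I -> R) (p : I -> 'rV[R]_n) :
  \sum_(i <- r) c i *: homog (p i) =
  row_mx (\sum_(i <- r) c i)%:M (\sum_(i <- r) c i *: p i).
Proof.
elim: r => [|i r IH]; first by rewrite !big_nil raddf0 row_mx0.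
rewrite !big_cons IH /homog scale_row_mx add_row_mx; congr row_mx.
by rewrite raddfD /= -[(c _)%:M]scalemx1.
Qed.

(** The lifts of n + 1 independent points span everything, in particular the
vectors of height 0, whose coefficients sum to zero. *)
Lemma indep_frame a s : indep (a :: s) -> size s = n ->
  forall F, exists c, F = \sum_(e <- s) c e *: (e - a).
Proof.
move=> ind sz F.
have full : <<map homog (a :: s)>>%VS = fullv.
  apply/eqP; rewrite eqEdim subvf /=; move: ind; rewrite /indep /free.
  by move=> /eqP ->; rewrite dimvf /dim /= size_map sz mul1n.
have /(free_span ind)[c Fc _] : row_mx 0 F \in <<map homog (a :: s)>>%VS.
  by rewrite full memvf.
exists (fun e => c (homog e)); move: Fc; rewrite big_map big_cons => Fc.
have E1 : row_mx 0 F = c (homog a) *: homog a +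
    row_mx (\sum_(e <- s) c (homog e))%:M (\sum_(e <- s) c (homog e) *: e).
  by rewrite Fc homog_lincomb.
move: E1; rewrite /homog scale_row_mx add_row_mx => /eq_row_mx [c0 ->].
have {}c0 : c (homog a) = - \sum_(e <- s) c (homog e).
  apply/eqP; rewrite -addr_eq0; apply/eqP.
  by move/matrixP/(_ 0 0): c0; rewrite !mxE eqxx mulr1 mulr1n => <-.
rewrite c0 scaleNr scaler_suml -sumrN -big_split /=.
by apply: eq_bigr => e _; rewrite scalerBr addrC.
Qed.

(** A proper subspace lies in the kernel of a nonzero linear map; evaluated on
the moment curve, a nonzero coordinate of that map is a nonzero polynomial in
the parameter.  The finitely many polynomials have a common non-root. *)
Lemma moment_avoids (Us : seq {vspace 'rV[R]_(1 + n)}) :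
  (forall U, U \in Us -> (\dim U <= n)%N) ->
  exists x, forall U, U \in Us -> homog x \notin U.
Proof.
move=> dimU; pose M (t : R) : 'rV[R]_(1 + n) := \row_i t ^+ i.
have homM (t : R) : M t = homog (\row_i t ^+ i.+1).
  apply/rowP => i; rewrite /homog; case: (split_ordP i) => j ->.
    by rewrite row_mxEl !mxE ord1 eqxx expr0.
  by rewrite row_mxEr !mxE.
have polyU (U : {vspace 'rV[R]_(1 + n)}) : (\dim U <= n)%N ->
    exists2 p : {poly R}, p != 0 & forall t : R, M t \in U -> root p t.
  (* the projection away from U *)
  move=> dU; pose g := (\1 - projv U)%VF.
  have gU w : w \in U -> g w = 0.
    by move=> wU; rewrite /g lfunE /= lfunE /= opp_lfunE projv_id // subrr.
  have [w wU] : exists w, w \notin U.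
    have /subvPn[w _ wU] : ~~ (fullv <= U)%VS.
      by apply/negP => /dimvS; rewrite dimvf /dim /= mul1n => /leq_trans/(_ dU);
        rewrite ltnn.
    by exists w.
  have gw : g w != 0.
    apply: contra wU; rewrite /g lfunE /= lfunE /= opp_lfunE subr_eq0 => /eqP ->.
    exact: memv_proj.
  have gE (v : 'rV[R]_(1 + n)) j : (g v) 0 j = \sum_i v 0 i * (g (delta_mx 0 i)) 0 j.
    rewrite {1}(row_sum_delta v) linear_sum summxE; apply: eq_bigr => i _.
    by rewrite linearZ mxE.
  have [j gj] : exists j, (g w) 0 j != 0 by apply/rV0Pn.
  exists (\poly_(i < 1 + n) (if insub i is Some i' then (g (delta_mx 0 i')) 0 j else 0)).
    apply: contra gj => /eqP p0; rewrite gE big1 // => i _.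
    move/(congr1 (fun p : {poly R} => p`_i)): p0; rewrite coef_poly ltn_ord coef0.
    by rewrite valK => ->; rewrite mulr0.
  move=> t /gU gt0; apply/rootP; rewrite horner_poly.
  transitivity ((g (M t)) 0 j); last by rewrite gt0 mxE.
  by rewrite gE; apply: eq_bigr => i _; rewrite valK mxE mulrC.
have [p p0 pr] : exists2 p : {poly R}, p != 0 &
    forall (t : R) U, U \in Us -> M t \in U -> root p t.
  elim: Us dimU => [|U Us IH] dimU.
    by exists 1; rewrite ?oner_eq0.
  have [|p p0 pr] := IH; first by move=> V VU; apply: dimU; rewrite inE VU orbT.
  have [|q q0 qr] := polyU U; first by apply: dimU; rewrite inE eqxx.
  exists (q * p) => [|t V]; first by rewrite mulf_neq0.
  rewrite rootM inE => /predU1P[-> /qr -> //|VU /(pr _ _ VU) ->]; exact: orbT.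
have [t tp] : exists t : R, ~~ root p t.
  pose rs := [seq i%:R | i <- iota 0 (size p)] : seq R.
  have urs : uniq rs.
    by rewrite map_inj_uniq ?iota_uniq // => i j /eqP; rewrite eqr_nat => /eqP.
  have /allPn[t _ tp] : ~~ all (root p) rs.
    apply/negP => ars; have := max_poly_roots p0 ars urs.
    by rewrite size_map size_iota ltnn.
  by exists t.
exists (\row_i t ^+ i.+1) => U UUs; rewrite -homM; apply/negP.
by move=> /(pr _ _ UUs); apply/negP.
Qed.

(** Infinitely many lists t are allowed, but their spans are those of the
subsequences of s without repetitions. *)
Lemma avoids_small_spans s : exists x, forall t, {subset t <= s} ->
  (size t <= n)%N -> homog x \notin <<map homog t>>%VS.
Proof.
pose u := undup s.
pose Us := [seq V <- [seq <<map homog (mask (val m) u)>>%VS | m : (size u).-tuple bool]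
  | (\dim V <= n)%N].
have [U|x xU] := @moment_avoids Us; first by rewrite mem_filter => /andP[].
exists x => t ts szt; apply: xU; rewrite mem_filter.
rewrite (leq_trans (dim_span _)) ?size_map //=; apply/fintype.imageP.
exists [tuple of map (mem t) (in_tuple u)] => //=.
rewrite -filter_mask; apply: eq_span => w.
apply/mapP/mapP => -[z zt ->]; exists z => //.
  by rewrite mem_filter /= zt mem_undup ts.
by move: zt; rewrite mem_filter => /andP[].
Qed.

Fixpoint generic S xs : Prop :=
  if xs is x :: xs' then
    (forall t, {subset t <= S ++ xs'} -> (size t <= n)%N ->
       homog x \notin <<map homog t>>%VS) /\ generic S xs'
  else True.

Lemma generic_exists S N : exists2 xs, size xs = N & generic S xs.
Proof.
elim: N => [|N [xs <- gxs]]; first by exists [::].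
by have [x hx] := avoids_small_spans (S ++ xs); exists (x :: xs).
Qed.

Lemma generic_uniq S xs : (0 < n)%N -> generic S xs -> uniq xs.
Proof.
move=> n0; elim: xs => //= x xs IH [hx /IH ->]; rewrite andbT; apply/negP => xxs.
have /negP[] : homog x \notin <<map homog [:: x]>>%VS; last exact/memv_span/mem_head.
by apply: hx => // y; rewrite inE => /eqP ->; rewrite mem_cat xxs orbT.
Qed.

(** The points of S may be in special position with respect to each other; the
new points can still be added one by one to an independent part of S. *)
Lemma generic_indep S xs A J : generic S xs -> indep A -> {subset A <= S} ->
  uniq J -> {subset J <= xs} -> (size A + size J <= n.+1)%N -> indep (A ++ J).
Proof.
move=> + iA AS; elim: xs J => [|x xs IH] J /=.
  by case: J => [|y J] _ _ Jxs; rewrite ?cats0 //; have := Jxs y (mem_head _ _).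
move=> [hx gxs] uJ Jxs szJ.
have [xJ|xJ] := boolP (x \in J); last first.
  apply: IH => // y yJ; have := Jxs y yJ; rewrite inE => /predU1P[yx|//].
  by rewrite -yx yJ in xJ.
have pJ := perm_to_rem xJ.
have pAJ : perm_eq (A ++ J) (x :: (A ++ rem x J)).
  apply: perm_trans (_ : perm_eq _ (A ++ (x :: rem x J))) _.
    by rewrite perm_cat2l.
  by rewrite (perm_catCA A [:: x]).
have sub : {subset rem x J <= xs}.
  move=> y; rewrite mem_rem_uniq // !inE => /andP[yx yJ].
  by have := Jxs y yJ; rewrite inE (negPf yx).
have szr : (size A + size (rem x J) <= n)%N.
  by move: szJ; rewrite (perm_size pJ) /= addnS ltnS.
rewrite (indep_perm pAJ) indep_cons; apply/andP; split; last first.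
  by apply: IH => //; rewrite ?rem_uniq // ltnW.
apply: hx; last by rewrite size_cat.
by move=> y; rewrite !mem_cat => /orP[/AS ->//|/sub ->]; rewrite orbT.
Qed.

End GeneralPosition.

(** * Vanishing of second differences *)

(** There is no division in M, but the argument of phi can be halved. *)
Lemma halving (R : numFieldType) (U : lmodType R) (M : zmodType)
    (phi : {additive U -> M}) u : (forall l : R, phi (l *: u) = - phi (l *: u)) -> phi u = 0.
Proof.
move=> odd; have -> : u = (2^-1 : R) *: u + (2^-1 : R) *: u.
  by rewrite -scalerDl (_ : _ + _ = 1) ?scale1r //; field.
by rewrite raddfD /= {1}odd addNr.
Qed.

Section SecondDifference.
Context {R : numFieldType} {n : nat} {M : zmodType}.
Implicit Types (a b c d e x y z F : 'rV[R]_n) (l : R).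

(** Here q x y F is the class of the load F on the simplex with vertices x, y
and other vertices that stay fixed, and ok selects the points that can serve
as further vertices. *)
Variables (ok : pred 'rV[R]_n) (q : 'rV[R]_n -> 'rV[R]_n -> {additive 'rV[R]_n -> M}).

Definition free4 a b c d := uniq [:: a; b; c; d] && all ok [:: a; b; c; d].

Hypothesis qC : forall x y, q x y =1 q y x.
Hypothesis q_beam : forall x y z l, ok x -> ok y -> ok z -> x != y -> x != z ->
  y != z -> q x y (l *: (z - x)) = q z y (l *: (z - x)).

Definition diff2 a b c d : {additive 'rV[R]_n -> M} :=
  (q b d \- q a d) \- (q b c \- q a c).

Lemma diff2E a b c d F : diff2 a b c d F = q b d F - q a d F - (q b c F - q a c F).
Proof. by []. Qed.

Lemma free4_perm a b c d a' b' c' d' :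
  perm_eq [:: a'; b'; c'; d'] [:: a; b; c; d] -> free4 a b c d -> free4 a' b' c' d'.
Proof. by move=> p; rewrite /free4 (perm_uniq p) (perm_all _ p). Qed.

(** The second difference, in the displacements b - a and d - c, for a force from
one displaced vertex to the other.  The following four lemmas give the effect of
some transpositions of a, b, c, d on it; the signs are incompatible with a
nonzero value, since the transposition of b and d is conjugate to that of c
and d. *)
Definition torsion l a b c d := diff2 a b c d (l *: (c - a)).

Lemma free4P a b c d : free4 a b c d ->
  [/\ [/\ a != b, a != c & a != d], [/\ b != c, b != d & c != d] &
   [/\ ok a, ok b, ok c & ok d]].
Proof.
rewrite /free4 /= !inE !negb_or !andbT.
by move=> /andP[/and3P[/and3P[-> -> ->] /andP[-> ->] ->] /and4P[-> -> -> ->]].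
Qed.

Lemma torsion24 l a b c d : free4 a b c d -> torsion l a b c d = torsion l a d c b.
Proof.
move=> /free4P[[ab ac ad] [bc bd cd] [oa ob oc od]].
rewrite /torsion !diff2E (qC d b) (qC b c) (qC d c).
rewrite (q_beam (y := d) (z := c)) // 1?[_ == c]eq_sym //.
rewrite (q_beam (x := a) (y := b) (z := c)) //.
by rewrite !opprB !addrA (ACl (1 * 4 * 3 * 2)).
Qed.

Lemma torsion13 l a b c d : free4 a b c d -> torsion l a b c d = - torsion l c b a d.
Proof.
move=> /free4P[[ab ac ad] [bc bd cd] [oa ob oc od]].
rewrite /torsion !diff2E -(opprB c a) scalerN !raddfN /= (qC b c) (qC c a) (qC b a).
rewrite (q_beam (y := d) (z := c)) // 1?[_ == c]eq_sym //.
rewrite (q_beam (x := a) (y := b) (z := c)) //.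
by rewrite -!opprD opprK.
Qed.

(** The second difference vanishes on b - a, by the sliding rule, so that c - a
can be replaced by c - b. *)
Lemma torsion12 l a b c d : free4 a b c d -> torsion l a b c d = - torsion l b a c d.
Proof.
move=> /free4P[[ab ac ad] [bc bd cd] [oa ob oc od]].
have -> : torsion l a b c d = diff2 a b c d (l *: (c - b)).
  rewrite /torsion -(subrKA b c) scalerDr raddfD /= [X in _ + X]diff2E.
  rewrite (q_beam (y := d) (z := b)) // 1?[_ == b]eq_sym // subrr.
  rewrite (qC b c) (q_beam (x := a) (y := c) (z := b)) // 1?[_ == b]eq_sym //.
  by rewrite (qC b c) subrr subrr addr0.
by rewrite /torsion !diff2E -[q b d _ - _]opprB -[q b c _ - _]opprB -opprD.
Qed.

(** The second difference vanishes on d - c, by the sliding rule, so that c - a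
can be replaced by d - a. *)
Lemma torsion34 l a b c d : free4 a b c d -> torsion l a b c d = - torsion l a b d c.
Proof.
move=> /free4P[[ab ac ad] [bc bd cd] [oa ob oc od]].
have -> : torsion l a b c d = diff2 a b c d (l *: (d - a)).
  rewrite /torsion -(subrKA c d (- a)) (scalerDr l (d - c)).
  rewrite (raddfD (diff2 a b c d)) [X in _ = X + _]diff2E.
  rewrite (qC b c) (qC a c) (qC b d) (qC a d) !(q_beam (x := c) (z := d)) // 1?eq_sym //.
  by rewrite subrr add0r.
by rewrite /torsion !diff2E -opprB.
Qed.

Ltac reorder4 abcd := apply: free4_perm abcd; apply/seq.permP => ? /=; lia.

Lemma torsion_odd l a b c d : free4 a b c d -> torsion l a b c d = - torsion l a b c d.
Proof.
move=> abcd.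
have swap23 w x y z : free4 w x y z -> torsion l w x y z = - torsion l w y x z.
  move=> wxyz; rewrite torsion12 // torsion13; last by reorder4 wxyz.
  by rewrite opprK torsion12 //; reorder4 wxyz.
rewrite [LHS]torsion24 // [LHS]torsion34; last by reorder4 abcd.
rewrite [in LHS]swap23; last by reorder4 abcd.
by rewrite opprK [LHS]torsion34 //; reorder4 abcd.
Qed.

Lemma diff2_torsion0 l a b c d : free4 a b c d -> diff2 a b c d (l *: (c - a)) = 0.
Proof.
move=> abcd; apply: halving => l'; rewrite scalerA; exact: torsion_odd.
Qed.

Lemma diff2_split a b c d e F : diff2 a b c d F = diff2 a b c e F + diff2 a b e d F.
Proof. by rewrite !diff2E [RHS]addrC subrKA. Qed.

(** Going from c to d through e makes e a displaced vertex, so that the force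
e - a is of the previous type, in both terms. *)
Lemma diff2_fifth l a b c d e : ok e -> e \notin [:: a; b; c; d] -> free4 a b c d ->
  diff2 a b c d (l *: (e - a)) = 0.
Proof.
move=> oe; rewrite !inE !negb_or => /and4P[ea eb ec ed] abcd.
move: (abcd) => /free4P[[ab ac ad] [bc bd cd] [oa ob oc od]].
have f4 w : ok w -> w \notin [:: a; b; e] -> free4 a b e w.
  move=> ow; rewrite !inE !negb_or => /and3P[wa wb we].
  rewrite /free4 /= !inE !negb_or ab oa ob oe ow.
  by rewrite ![_ == e]eq_sym ![_ == w]eq_sym wa wb we ea eb.
rewrite (diff2_split _ _ _ _ e) (diff2_torsion0 _ (f4 d _ _)) //; last first.
  by rewrite !inE ![d == _]eq_sym (negPf ad) (negPf bd) (negPf ed).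
rewrite addr0; apply/eqP; rewrite -oppr_eq0; apply/eqP.
rewrite -(diff2_torsion0 l (f4 c _ _)) //; first by rewrite !diff2E opprB.
by rewrite !inE ![c == _]eq_sym (negPf ac) (negPf bc) (negPf ec).
Qed.

(** The directions from a to enough further points span all forces. *)
Lemma diff2_eq0 a b c d s : free4 a b c d -> indep (a :: s) -> size s = n ->
  (forall e, e \in s -> ok e && (e \notin [:: a; b; c; d])) -> diff2 a b c d =1 \0.
Proof.
move=> abcd ind sz sok F; have [k ->] := indep_frame ind sz F.
rewrite raddf_sum big_seq big1 // => e /sok/andP[oe ne].
exact: diff2_fifth.
Qed.

End SecondDifference.

(** * Loads modulo the sliding rule *)

Ltac perm_solve := apply/seq.permP => ? /=; rewrite ?(count_cat, cat_cons) /= ?count_cat; lia.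

Lemma pick_avoiding (T : eqType) (xs t : seq T) N : uniq xs ->
  (N + size t <= size xs)%N ->
  exists s, [/\ uniq s, {subset s <= xs}, size s = N & forall e, e \in s -> e \notin t].
Proof.
move=> uxs szN; pose ys := [seq x <- xs | x \notin t].
have szy : (N <= size ys)%N.
  have : (size [seq x <- xs | x \in t] <= size t)%N.
    by apply: uniq_leq_size; rewrite ?filter_uniq // => x; rewrite mem_filter => /andP[].
  have := count_predC (mem t) xs; rewrite -!size_filter -/ys /= => E le_t.
  by rewrite -(leq_add2r (size t)) (leq_trans szN) // -E addnC leq_add2l.
exists (take N ys); split.
- by rewrite take_uniq // filter_uniq.
- by move=> x /mem_take; rewrite mem_filter => /andP[].
- by rewrite size_takel.
- by move=> x /mem_take; rewrite mem_filter => /andP[].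
Qed.

(** The elements of s are exchanged for those of t one at a time; the
disjointness of s and t keeps the intermediate lists free of repetitions. *)
Lemma swap_invariant (T : eqType) (V : Type) (psi : seq T -> V) (zs : seq T) m :
  (forall s t, perm_eq s t -> psi s = psi t) ->
  (forall c d r, uniq [:: c, d & r] -> {subset [:: c, d & r] <= zs} ->
     (size r).+1 = m -> psi (c :: r) = psi (d :: r)) ->
  forall s t, uniq (s ++ t) -> {subset s ++ t <= zs} -> size s = m -> size t = m ->
  psi s = psi t.
Proof.
move=> psi_perm psi_swap s t ust sub szs szt.
suff gen : forall s t r, uniq (s ++ t ++ r) -> {subset s ++ t ++ r <= zs} ->
    size s = size t -> (size t + size r)%N = m -> psi (s ++ r) = psi (t ++ r).
  have := gen s t [::]; rewrite !cats0; apply=> //; first by rewrite szs szt.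
  by rewrite addn0.
move=> {s t ust sub szs szt}; elim=> [|c s IH] [|d t] r // u sub /= [szst] szr.
transitivity (psi (d :: s ++ r)).
  apply: psi_swap; last by rewrite size_cat szst -addSn.
    have p : perm_eq (c :: s ++ d :: t ++ r) ([:: c, d & s ++ r] ++ t) by perm_solve.
    by move: u; rewrite (perm_uniq p) cat_uniq => /andP[].
  by move=> x; rewrite !(inE, mem_cat) => h; apply: sub; rewrite !(inE, mem_cat); lia.
rewrite (psi_perm (d :: s ++ r) (s ++ d :: r)); last by perm_solve.
rewrite (psi_perm (d :: t ++ r) (t ++ d :: r)); last by perm_solve.
have p : perm_eq (c :: s ++ d :: t ++ r) (c :: (s ++ t ++ d :: r)) by perm_solve.
apply: IH => //; last by rewrite /= addnS -addSn.
  by move: u; rewrite (perm_uniq p) => /andP[].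
by move=> x; rewrite !(inE, mem_cat) => h; apply: sub; rewrite !(inE, mem_cat); lia.
Qed.

Section Core.
Context {R : numFieldType} {n m : nat} {M : zmodType}.
Implicit Types (a b c d e p x y z F : 'rV[R]_n) (l : R) (s t r J : seq 'rV[R]_n).

(** f s F stands for the class, in an abelian group M, of the force F on the
simplex with vertices s, of dimension m. *)
Variable f : seq 'rV[R]_n -> {additive 'rV[R]_n -> M}.
Hypothesis dim_gt : (m < n)%N.
Hypothesis f_perm : forall s t, perm_eq s t -> f s =1 f t.
Hypothesis f_beam : forall a b t l, indep [:: a, b & t] -> size t = m ->
  f (a :: t) (l *: (b - a)) = f (b :: t) (l *: (b - a)).

Section OnGenericPoints.

(** S contains the vertices of the given simplices, and xs consists of
auxiliary points in general position with respect to S. *)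
Variables S xs : seq 'rV[R]_n.
Hypothesis xs_uniq : uniq xs.
Hypothesis mixed_indep : forall s J, indep s -> {subset s <= S} -> uniq J ->
  {subset J <= xs} -> (size s + size J <= n.+1)%N -> indep (s ++ J).

Lemma xs_indep J : uniq J -> {subset J <= xs} -> (size J <= n.+1)%N -> indep J.
Proof. by apply: (@mixed_indep [::]) => //; apply: nil_free. Qed.

Definition picked s := uniq s && all (mem xs) s.

Lemma picked_perm s t : perm_eq s t -> picked s = picked t.
Proof. by move=> p; rewrite /picked (perm_uniq p) (perm_all _ p). Qed.

Lemma beam_in a b t l : picked [:: a, b & t] -> size t = m ->
  f (a :: t) (l *: (b - a)) = f (b :: t) (l *: (b - a)).
Proof.
move=> /andP[u /allP sub] sz; apply: f_beam => //; apply: xs_indep => //.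
by rewrite /= sz ltnS.
Qed.

Definition move t a b : {additive 'rV[R]_n -> M} := f (b :: t) \- f (a :: t).

Lemma moveE t a b F : move t a b F = f (b :: t) F - f (a :: t) F.
Proof. by []. Qed.

(** The vanishing of the second difference in the vertices a -> b and c -> d.
Besides a, b, c, d and the m - 1 points of r, it takes n more points to span
the forces, which is where the bound on the size of xs comes from. *)
Lemma move_swap a b c d r : (n + m + 3 <= size xs)%N ->
  picked [:: a, b, c, d & r] -> (size r).+1 = m ->
  move (c :: r) a b =1 move (d :: r) a b.
Proof.
move=> sz_xs pk szr F.
pose ok := [pred x | (x \in xs) && (x \notin r)].
pose q x y := f [:: x, y & r].
have qC x y : q x y =1 q y x by apply: f_perm; perm_solve.
have q_beam x y z l : ok x -> ok y -> ok z -> x != y -> x != z -> y != z ->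
    q x y (l *: (z - x)) = q z y (l *: (z - x)).
  move=> /andP[xx xr] /andP[yx yr] /andP[zx zr] xy xz yz.
  apply: beam_in => //; move: pk; rewrite /picked /= !inE !negb_or [z == y]eq_sym.
  by rewrite xy xz yz xr yr zr xx yx zx
    => /andP[/and5P[_ _ _ _ ->] /and5P[_ _ _ _ ->]].
have [s [us sub szs ne]] : exists s, [/\ uniq s, {subset s <= xs}, size s = n &
    forall e, e \in s -> e \notin [:: a, b, c, d & r]].
  apply: pick_avoiding => //=; lia.
have abcd : free4 ok a b c d.
  move: pk; rewrite /picked /free4 /= !inE !negb_or => /andP[].
  move=> /and5P[/and4P[-> -> -> ->] /and3P[-> -> ->] /andP[-> ->] -> _].
  by move=> /and5P[-> -> -> ->].
have ind : indep (a :: s).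
  apply: xs_indep; rewrite /= ?szs ?us ?andbT //.
    by apply/negP => /ne; rewrite inE eqxx.
  move=> x; rewrite inE => /predU1P[->|/sub //].
  by case/free4P: abcd => _ _ [/andP[]].
have s_ok e : e \in s -> ok e && (e \notin [:: a; b; c; d]).
  move=> es; rewrite /= sub //=; have := ne e es; rewrite !inE !negb_or.
  by case/and5P=> -> -> -> -> ->.
have /eqP := diff2_eq0 qC q_beam abcd ind szs s_ok F.
by rewrite diff2E subr_eq0 => /eqP.
Qed.

Lemma move_const a b s t : (n + m + 3 <= size xs)%N ->
  picked (a :: b :: s ++ t) -> size s = m -> size t = m -> move s a b =1 move t a b.
Proof.
move=> sz_xs pk szs szt F.
have /andP[/and3P[a_st b_st st_uniq] /allP pk_xs] := pk.
apply: (@swap_invariant _ _ (fun s => move s a b F) (s ++ t) m) => //.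
  by move=> u v uv; rewrite !moveE; congr (_ - _); apply: f_perm; rewrite perm_cons.
move=> c d r cdr cdr_st szr; apply: move_swap => //.
apply/andP; split; last first.
  apply/allP => x; rewrite !inE => x_in; apply: pk_xs; rewrite !inE.
  by case/or3P: x_in => [->|->|/cdr_st ->]; rewrite ?orbT.
move: a_st; rewrite inE negb_or => /andP[ab a_st].
rewrite 2!cons_uniq cdr inE negb_or ab !andbT /=; apply/andP; split.
  by apply: contra a_st => /cdr_st.
by apply: contra b_st => /cdr_st.
Qed.

(** The auxiliary points are split according to their roles: o is the origin,
t0 the fixed part of the simplices used to measure slopes, r0 a reference
simplex, and ws the supply of vertices.  Keeping these apart makes every
comparison one between disjoint simplices. *)
Variables (o : 'rV[R]_n) (t0 r0 ws : seq 'rV[R]_n).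
Hypothesis xs_def : xs = o :: t0 ++ r0 ++ ws.
Hypothesis size_t0 : size t0 = m.
Hypothesis size_r0 : size r0 = m.+1.
Hypothesis size_ws : (n + m < size ws)%N.

Let size_xs : (n + m + 3 <= size xs)%N.
Proof. by rewrite xs_def /= !size_cat size_t0 size_r0; lia. Qed.

Definition slope p : {additive 'rV[R]_n -> M} := move t0 o p.

Lemma picked_xs s : uniq s -> {subset s <= xs} -> picked s.
Proof. by move=> us /allP sub; rewrite /picked us. Qed.

Lemma slopeB p q t F : uniq [:: p, q & t] -> {subset [:: p, q & t] <= r0 ++ ws} ->
  size t = m -> f (p :: t) F - f (q :: t) F = slope p F - slope q F.
Proof.
move=> u sub szt; rewrite -moveE (@move_const _ _ t t0) //.
  by rewrite !moveE opprB addrA subrK.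
have pq : perm_eq ([:: q, p & t] ++ t0) (t0 ++ [:: p, q & t]) by perm_solve.
rewrite (picked_perm pq); apply: picked_xs.
  have := xs_uniq; rewrite xs_def cons_uniq cat_uniq => /and4P[_ ut0 t0_rw _].
  rewrite cat_uniq ut0 u andbT; apply: contra t0_rw => /hasP[x /sub x_rw x_t0].
  by apply/hasP; exists x.
move=> x; rewrite xs_def inE !mem_cat => /orP[->|/sub]; rewrite ?orbT //.
by rewrite mem_cat => ->; rewrite !orbT.
Qed.

Definition offset F : M := f r0 F - \sum_(p <- r0) slope p F.

Fact offset_is_zmod_morphism : zmod_morphism offset.
Proof.
move=> u v; rewrite /offset raddfB.
under eq_bigr do rewrite raddfB.
by rewrite sumrB !opprD addrACA.
Qed.

HB.instance Definition _ := GRing.isZmodMorphism.Build 'rV[R]_n M offset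
  offset_is_zmod_morphism.

(** Subtracting the slopes makes f invariant under the exchange of one vertex;
its value is then the one on the reference simplex. *)
Lemma f_slope s F : uniq s -> {subset s <= ws} -> size s = m.+1 ->
  f s F = offset F + \sum_(p <- s) slope p F.
Proof.
move=> us sub szs; apply/eqP; rewrite -subr_eq; apply/eqP.
apply: (@swap_invariant _ _ (fun s => f s F - \sum_(p <- s) slope p F) (r0 ++ ws) m.+1) => //.
- by move=> u v uv; rewrite (f_perm uv) (perm_big _ uv).
- move=> c d r cdr cdr_rw [szr]; rewrite !big_cons.
  rewrite (opprD (slope c F)) (opprD (slope d F)) !addrA; congr (_ - _).
  have /eqP := slopeB F cdr cdr_rw szr; rewrite subr_eq => /eqP ->.
  by rewrite (ACl (1 * 4 * 3 * 2)) /= subrr add0r.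
- have := xs_uniq; rewrite xs_def /= !cat_uniq => /and5P[_ _ _ u_r0 /andP[r0_ws _]].
  rewrite us u_r0 andbT; apply: contra r0_ws => /hasP[x x_r0 /sub x_ws].
  by apply/hasP; exists x.
- by move=> x; rewrite !mem_cat => /orP[/sub ->|->]; rewrite ?orbT.
Qed.

Lemma late_xs p : p \in r0 ++ ws -> (p \in xs) && (p \notin o :: t0).
Proof.
move=> p_rw; have := xs_uniq; rewrite xs_def -cat_cons cat_uniq => /and3P[_ disj _].
by rewrite mem_cat p_rw orbT; apply: contra disj => p_ot0; apply/hasP; exists p.
Qed.

Lemma early_xs : uniq (o :: t0) /\ {subset o :: t0 <= xs}.
Proof.
split; first by have := xs_uniq; rewrite xs_def -cat_cons cat_uniq => /and3P[].
by move=> x; rewrite xs_def -cat_cons mem_cat => ->.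
Qed.

Lemma picked_base p : p \in r0 ++ ws -> picked [:: o, p & t0].
Proof.
move=> /late_xs/andP[p_xs]; rewrite inE negb_or => /andP[po pt].
have [ot0 ot0_xs] := early_xs; apply: picked_xs.
  by move: ot0; rewrite /= inE negb_or eq_sym po pt => ->.
move=> y; rewrite !inE => /or3P[/eqP->|/eqP->//|y_t0].
  by apply: ot0_xs; rewrite mem_head.
by apply: ot0_xs; rewrite inE y_t0 orbT.
Qed.

Lemma slope_self p l : p \in r0 ++ ws -> slope p (l *: (p - o)) = 0.
Proof. by move=> /picked_base pk; rewrite /slope moveE beam_in // subrr. Qed.

(** By the sliding rule each slope is a difference between the simplices p :: t0
and q :: t0, and the sum of the two such differences is the one for the force
l (q - p), which can slide from p to q. *)
Lemma slope_alt p q l : p \in r0 ++ ws -> q \in r0 ++ ws ->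
  slope p (l *: (q - o)) = - slope q (l *: (p - o)).
Proof.
move=> p_rw q_rw; have [->|pq] := eqVneq p q; first by rewrite !slope_self // oppr0.
have [+ ot0_xs] := early_xs; rewrite cons_uniq => /andP[_ ut0].
have /andP[p_xs p_ot] := late_xs p_rw; have /andP[q_xs q_ot] := late_xs q_rw.
apply/eqP; rewrite -addr_eq0 /slope !moveE !(beam_in _ (picked_base _)) //.
have -> : l *: (q - o) = l *: (q - p) + l *: (p - o) by rewrite -scalerDr subrKA.
rewrite !(raddfD (f (_ :: _))) (beam_in l (_ : picked [:: p, q & t0])) //.
  by rewrite opprD [X in X + _]addrACA subrr add0r -opprB addNr.
move: p_ot q_ot; rewrite !inE !negb_or => /andP[_ pt] /andP[_ qt]; apply: picked_xs.
  by rewrite /= inE negb_or pq pt qt ut0.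
move=> x; rewrite !inE => /or3P[/eqP->|/eqP->|x_t0] //.
by apply: ot0_xs; rewrite inE x_t0 orbT.
Qed.

Let e (j : 'I_n) := nth 0 ws j.

Let e_ws j : e j \in ws.
Proof.
apply: mem_nth; rewrite (leq_trans (ltn_ord j)) // ltnW //.
by rewrite (leq_ltn_trans _ size_ws) // leq_addr.
Qed.

Let ws_rw p : p \in ws -> p \in r0 ++ ws.
Proof. by move=> pws; rewrite mem_cat pws orbT. Qed.

Definition frame : 'M[R]_n := \matrix_j (e j - o).

(** The n directions e j - o form a basis, by general position. *)
Lemma frame_unit : frame \in unitmx.
Proof.
have n_ws : (n <= size ws)%N by rewrite ltnW // (leq_ltn_trans _ size_ws) // leq_addr.
have tk : uniq (o :: take n ws).
  rewrite /= take_uniq; last first.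
    by have := xs_uniq; rewrite xs_def /= !cat_uniq => /and5P[_ _ _ _ /andP[]].
  rewrite andbT; apply/negP => /mem_take/ws_rw/late_xs/andP[_].
  by rewrite mem_head.
have ind : indep (o :: take n ws).
  apply: xs_indep => //; last by rewrite /= size_takel.
  move=> x; rewrite inE => /predU1P[->|/mem_take/ws_rw/late_xs/andP[]//].
  by apply: early_xs.2; rewrite mem_head.
rewrite -row_full_unit -sub1mx; apply/row_subP => i.
have [c ->] := indep_frame ind (size_takel n_ws) (row i 1%:M).
rewrite big_seq; apply: summx_sub => x x_tk; apply: scalemx_sub.
have ix : (index x (take n ws) < n)%N by rewrite -[X in (_ < X)%N](size_takel n_ws) index_mem.
have -> : x - o = row (Ordinal ix) frame; last exact: row_sub.
by rewrite rowK /e /= -(nth_take 0 ix) nth_index.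
Qed.

(** The bilinear extension of [slope]: coordinates of v are passed to the second
argument, as M has no scalar multiplication. *)
Definition form (v F : 'rV[R]_n) : M := \sum_j slope (e j) ((v *m invmx frame) 0 j *: F).

Lemma frame_coord v : v = \sum_j (v *m invmx frame) 0 j *: (e j - o).
Proof.
rewrite -{1}(mulmxKV frame_unit v) mulmx_sum_row.
by apply: eq_bigr => j _; rewrite rowK.
Qed.

Fact form_is_zmod_morphism v : zmod_morphism (form v).
Proof.
move=> F G; rewrite /form -sumrB; apply: eq_bigr => j _.
by rewrite scalerBr raddfB.
Qed.

HB.instance Definition _ v := GRing.isZmodMorphism.Build 'rV[R]_n M (form v)
  (form_is_zmod_morphism v).

Lemma formZ l v F : form (l *: v) F = form v (l *: F).
Proof. by apply: eq_bigr => j _; rewrite -scalemxAl mxE mulrC scalerA. Qed.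

Lemma form_anti v F : form v F = - form F v.
Proof.
rewrite /form [in LHS](frame_coord F) [in RHS](frame_coord v).
transitivity (\sum_j \sum_i slope (e j)
    (((v *m invmx frame) 0 j * (F *m invmx frame) 0 i) *: (e i - o))).
  apply: eq_bigr => j _; rewrite scaler_sumr raddf_sum.
  by apply: eq_bigr => i _; rewrite scalerA.
rewrite exchange_big -sumrN; apply: eq_bigr => i _.
rewrite scaler_sumr raddf_sum -sumrN; apply: eq_bigr => j _.
by rewrite slope_alt ?ws_rw // scalerA mulrC.
Qed.

Lemma formDl v w F : form (v + w) F = form v F + form w F.
Proof. by rewrite form_anti raddfD opprD -!form_anti. Qed.

Lemma form_self v l : form v (l *: v) = 0.
Proof.
by apply: halving => lx; rewrite scalerA /=; rewrite [LHS]form_anti formZ.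
Qed.

Lemma slope_form p F : p \in ws -> slope p F = form (p - o) F.
Proof.
move=> p_ws; rewrite form_anti {1}(frame_coord F) raddf_sum /form -sumrN.
by apply: eq_bigr => j _; rewrite [LHS]slope_alt ?ws_rw.
Qed.

(** The size of s times the vector from o to the barycenter of s. *)
Definition lever s : 'rV[R]_n := \sum_(p <- s) (p - o).

Lemma lever_perm s t : perm_eq s t -> lever s = lever t.
Proof. exact: perm_big. Qed.

Lemma lever_cons p s : lever (p :: s) = p - o + lever s.
Proof. exact: big_cons. Qed.

Lemma form0l F : form 0 F = 0.
Proof. by rewrite form_anti raddf0 oppr0. Qed.

(** Induction on the number of vertices that are not auxiliary points.  The force
is decomposed along the directions from such a vertex a to n auxiliary points
p; each component lets a slide to p.  The lever changes by p - a, on which the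
form vanishes since the component is parallel to it. *)
Lemma f_mixed s J F : indep s -> {subset s <= S} -> uniq J -> {subset J <= ws} ->
  (size s + size J)%N = m.+1 ->
  f (s ++ J) F = offset F + form (lever (s ++ J)) F.
Proof.
elim: s J F => [|a s IH] J F ind sub uJ J_ws sz.
  rewrite f_slope //=; congr (_ + _).
  rewrite /lever (big_morph (form^~ F) (fun v w => formDl v w F) (form0l F)).
  by rewrite big_seq [RHS]big_seq; apply: eq_bigr => p /J_ws; exact: slope_form.
have ws_xs x : x \in ws -> x \in xs by move=> /ws_rw/late_xs/andP[].
have ws_uniq : uniq ws.
  by have := xs_uniq; rewrite xs_def /= !cat_uniq => /and5P[_ _ _ _ /andP[]].
have [szJ] : (size s + size J).+1 = m.+1 := sz.
have [] := @pick_avoiding _ ws J n ws_uniq.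
  by rewrite (leq_trans _ (ltnW size_ws)) // leq_add2l -szJ leq_addl.
move=> K [uK K_ws szK K_J].
have indK : indep (a :: K).
  rewrite -cat1s; apply: mixed_indep; rewrite ?indep1 //= ?szK //.
    by move=> x; rewrite inE => /eqP->; rewrite sub ?mem_head.
  by move=> x /K_ws/ws_xs.
have ind_s : indep s by move: ind; rewrite indep_cons => /andP[].
have sub_s : {subset s <= S} by move=> x x_s; rewrite sub // inE x_s orbT.
have step p l : p \in K -> f (a :: s ++ J) (l *: (p - a)) =
    offset (l *: (p - a)) + form (lever (a :: s ++ J)) (l *: (p - a)).
  move=> pK; have uniq_pJ : uniq (p :: J) by rewrite /= K_J.
  have pJ_ws : {subset p :: J <= ws}.
    by move=> x; rewrite inE => /predU1P[->|/J_ws //]; apply: K_ws.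
  have psJ : perm_eq (p :: s ++ J) (s ++ p :: J) by rewrite (perm_catCA [:: p]).
  rewrite f_beam; last 2 first.
  - have q : perm_eq [:: a, p & s ++ J] ((a :: s) ++ p :: J) by rewrite perm_cons.
    rewrite (indep_perm q); apply: mixed_indep => //.
      by move=> x /pJ_ws/ws_xs.
    by rewrite /= addSn addnS szJ ltnS.
  - by rewrite size_cat.
  rewrite (f_perm psJ) IH //; last by rewrite /= addnS szJ.
  congr (_ + _); rewrite -(lever_perm psJ) !lever_cons.
  have -> : p - o = p - a + (a - o) by rewrite subrKA.
  by rewrite -(addrA (p - a)) [LHS]formDl form_self add0r.
have [c ->] := indep_frame indK szK F.
rewrite cat_cons !raddf_sum /= -big_split /= big_seq [RHS]big_seq.
by apply: eq_bigr => p /step.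
Qed.

Lemma form_tensor v F : form v F =
  \sum_i \sum_j form (delta_mx 0 i) ((v^T *m F) i j *: delta_mx 0 j).
Proof.
rewrite {1}(row_sum_delta v) (big_morph (form^~ F) (fun v w => formDl v w F) (form0l F)).
apply: eq_bigr => i _; rewrite formZ {1}(row_sum_delta F) scaler_sumr raddf_sum.
by apply: eq_bigr => j _; rewrite scalerA mxE big_ord1 mxE.
Qed.

(** The value of a bilinear form on a sum of pairs only depends on the sum of their
tensor products; a skew form changes sign when that tensor is transposed. *)
Lemma form_sym_eq0 (I : finType) (v F : I -> 'rV[R]_n) :
  (\sum_i (v i)^T *m F i)^T = \sum_i (v i)^T *m F i -> \sum_i form (v i) (F i) = 0.
Proof.
set A := \sum_i _ => symA.
pose phi (A : 'M[R]_n) : M := \sum_i \sum_j form (delta_mx 0 i) (A i j *: delta_mx 0 j).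
have phiB : zmod_morphism phi.
  move=> B C; rewrite /phi -sumrB; apply: eq_bigr => i _; rewrite -sumrB.
  by apply: eq_bigr => j _; rewrite !mxE scalerBl raddfB.
pose phi' : {additive 'M[R]_n -> M} := HB.pack phi (GRing.isZmodMorphism.Build _ _ phi phiB).
have phi_tr B : phi B^T = - phi B.
  rewrite /phi exchange_big -sumrN; apply: eq_bigr => i _ /=; rewrite -sumrN.
  by apply: eq_bigr => j _; rewrite form_anti formZ mxE.
transitivity (phi' A).
  by rewrite raddf_sum; apply: eq_bigr => i _; exact: form_tensor.
apply: halving => l; rewrite -[in LHS]symA -linearZ; exact: phi_tr.
Qed.

Lemma balanced_sum_generic (I : finType) (F : I -> 'rV[R]_n) (s : I -> seq 'rV[R]_n) :
  (forall i, indep (s i)) -> (forall i, size (s i) = m.+1) ->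
  (forall i, {subset s i <= S}) -> \sum_i F i = 0 ->
  (\sum_i (\sum_(p <- s i) p)^T *m F i)^T = \sum_i (\sum_(p <- s i) p)^T *m F i ->
  \sum_i f (s i) (F i) = 0.
Proof.
move=> ind sz sub F0 torque.
have E i : f (s i) (F i) = offset (F i) + form (lever (s i)) (F i).
  by rewrite -{1 2}[s i]cats0 f_mixed //= ?sz ?addn0.
under eq_bigr do rewrite E.
rewrite big_split /= -raddf_sum F0 raddf0 add0r; apply: form_sym_eq0.
suff -> : \sum_i (lever (s i))^T *m F i = \sum_i (\sum_(p <- s i) p)^T *m F i by [].
have levE i : lever (s i) = \sum_(p <- s i) p - m.+1%:R *: o.
  by rewrite /lever sumrB big_const_seq count_predT iter_addr_0 sz scaler_nat.
under eq_bigr do rewrite levE raddfB mulmxBl.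
by rewrite sumrB -mulmx_sumr F0 mulmx0 subr0.
Qed.

End OnGenericPoints.

(** The symmetry hypothesis is the equilibrium of torques: the sum of the
vertices is m + 1 times the barycenter. *)
Theorem balanced_sum_eq0 (I : finType) (F : I -> 'rV[R]_n) (s : I -> seq 'rV[R]_n) :
  (forall i, indep (s i)) -> (forall i, size (s i) = m.+1) -> \sum_i F i = 0 ->
  (\sum_i (\sum_(p <- s i) p)^T *m F i)^T = \sum_i (\sum_(p <- s i) p)^T *m F i ->
  \sum_i f (s i) (F i) = 0.
Proof.
move=> ind sz F0 torque; pose S := flatten [seq s i | i : I].
have sub i : {subset s i <= S}.
  by move=> x x_s; apply/flattenP; exists (s i) => //; apply: fintype.image_f.
have [xs szx gen] := generic_exists S (1 + m + m.+1 + (n + m).+1).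
have xs_uniq := generic_uniq (leq_ltn_trans (leq0n _) dim_gt) gen.
case: xs szx gen xs_uniq => [|o xs] // [szx] gen xs_uniq.
apply: (@balanced_sum_generic S (o :: xs) _ _ o (take m xs)
  (take m.+1 (drop m xs)) (drop m.+1 (drop m xs))) => //.
- by move=> ? ? ? ? ? ? ?; apply: generic_indep gen _ _ _ _ _.
- by rewrite !cat_take_drop.
- by rewrite size_takel // szx; lia.
- by rewrite size_takel // size_drop szx; lia.
- by rewrite !size_drop szx; lia.
Qed.

End Core.

(** * Lexicographic order and orthonormal bases *)

Local Open Scope classical_set_scope.

Section Lexicographic.
Context {R : realType} {n : nat}.
Implicit Types (u v w : 'rV[R]_n).

Lemma lexlt_total u v : u != v -> lexlt u v \/ lexlt v u.
Proof.
move=> uv; have /existsP[i0 i0P] : [exists i, u 0 i != v 0 i].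
  apply: contraNT uv; rewrite negb_exists => /forallP h.
  by apply/eqP/rowP => i; have := h i; rewrite negbK => /eqP.
have [i iP min] := @arg_minnP _ i0 (fun i => u 0 i != v 0 i) (@nat_of_ord n) i0P.
have eq_lt (j : 'I_n) : (j < i)%N -> u 0 j = v 0 j.
  by move=> ji; apply/eqP; apply: contraTT ji => /min; rewrite -leqNgt.
by have [lt|lt|/eqP] := ltgtP (u 0 i) (v 0 i); [left|right|by rewrite (negPf iP)];
  exists i; split=> // j /eq_lt.
Qed.

Lemma lexlt_trans u v w : lexlt u v -> lexlt v w -> lexlt u w.
Proof.
move=> [i [ui ei]] [j [vj ej]]; have [ij|ji|/val_inj ij] := ltngtP i j.
- by exists i; rewrite -(ej i ij); split=> // h hi; rewrite ei // ej // (ltn_trans hi).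
- by exists j; rewrite (ei j ji); split=> // h hj; rewrite ei ?ej // (ltn_trans hj).
- subst j; exists i; rewrite (lt_trans ui) //; split=> // h hi.
  by rewrite ei // ej.
Qed.

Definition lexle u v := `[< lexlt u v >] || (u == v).

Lemma lex_sort (s : seq 'rV[R]_n) : uniq s -> exists2 t, perm_eq s t &
  forall i j, (i < j < size t)%N -> lexlt (nth 0 t i) (nth 0 t j).
Proof.
move=> us; exists (sort lexle s); first by rewrite perm_sym perm_sort.
have tot : total lexle.
  move=> u v; rewrite /lexle; have [->|uv] := eqVneq u v; first by rewrite orbT.
  by case: (lexlt_total uv) => /asboolP ->; rewrite ?orbT.
have tr : transitive lexle.
  move=> v u w /orP[/asboolP uv|/eqP -> //] /orP[/asboolP vw|/eqP <-]; apply/orP; left.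
    by apply/asboolP; apply: lexlt_trans vw.
  exact/asboolP.
move=> i j /andP[ij js]; have is_ := ltn_trans ij js.
have := sorted_ltn_nth tr 0 (sort_sorted tot s) i j is_ js ij.
by rewrite /lexle => /orP[/asboolP //|]; rewrite nth_uniq ?sort_uniq // ltn_eqF.
Qed.

End Lexicographic.

Section Orthonormal.
Context {R : realType} {n : nat}.
Implicit Types (u v w : 'rV[R]_n).

Lemma dotC u v : dot u v = dot v u.
Proof. by rewrite /dot !mxE; apply: eq_bigr => i _; rewrite !mxE mulrC. Qed.

Lemma dotZl (l : R) u v : dot (l *: u) v = l * dot u v.
Proof. by rewrite /dot -scalemxAl mxE. Qed.

Lemma dotZr (l : R) u v : dot u (l *: v) = l * dot u v.
Proof. by rewrite dotC dotZl dotC. Qed.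

Lemma dot_ge0 u : 0 <= dot u u.
Proof. by rewrite /dot mxE sumr_ge0 // => i _; rewrite mxE -expr2 sqr_ge0. Qed.

Lemma dot_eq0 u : dot u u = 0 -> u = 0.
Proof.
rewrite /dot mxE => /eqP; rewrite psumr_eq0 => [/allP h|i _].
  apply/rowP => i; have := h i; rewrite mem_index_enum => /(_ isT).
  by rewrite !mxE -expr2 sqrf_eq0 => /eqP.
by rewrite mxE -expr2 sqr_ge0.
Qed.

Lemma lex_unit u : u != 0 ->
  exists c, [/\ c != 0, dot (c *: u) (c *: u) = 1 & lexlt 0 (c *: u)].
Proof.
move=> u0; have uu : 0 < dot u u.
  by rewrite lt_def dot_ge0 andbT; apply: contra u0 => /eqP/dot_eq0 ->.
pose c := (Num.sqrt (dot u u))^-1.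
have c0 : c != 0 by rewrite invr_eq0 gt_eqF // sqrtr_gt0.
have cc : dot (c *: u) (c *: u) = 1.
  by rewrite dotZl dotZr mulrA -expr2 /c exprVn sqr_sqrtr ?ltW // mulVf // gt_eqF.
have cu0 : 0 != c *: u by rewrite eq_sym scaler_eq0 negb_or c0.
have [pos|neg] := lexlt_total cu0; first by exists c.
exists (- c); split; rewrite ?oppr_eq0 // ?scaleNr.
  by rewrite -scaleN1r dotZl dotZr cc mulr1 mulrNN mulr1.
case: neg => i [lt0 eq0]; exists i; split=> [|j /eq0]; rewrite !mxE ?oppr_gt0.
  by move: lt0; rewrite !mxE.
by move=> ->; rewrite oppr0.
Qed.

Definition orthonormal_in m k (E : 'M[R]_(m, n)) (v : 'I_k -> 'rV[R]_n) :=
  [/\ forall i j, dot (v i) (v j) = (i == j)%:R, forall j, (v j <= E)%MS &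
      forall j, lexlt 0 (v j)].

(** The vectors x E orthogonal to all the v j form the kernel of a matrix with m
rows and k < m columns. *)
Lemma orthonormal_extend m (E : 'M[R]_(m, n)) k (v : 'I_k -> 'rV[R]_n) :
  row_free E -> (k < m)%N -> orthonormal_in E v ->
  exists w : 'rV[R]_n, [/\ dot w w = 1, forall j, dot (v j) w = 0, (w <= E)%MS & lexlt 0 w].
Proof.
move=> freeE km [orth vE pos]; pose V := \matrix_j v j.
have /rowV0Pn[x /sub_kermxP xEV x0] : kermx (E *m V^T) != 0.
  rewrite kermx_eq0; apply/negP => /eqP rk.
  by have := rank_leq_col (E *m V^T); rewrite rk leqNgt km.
have xE0 : x *m E != 0 by rewrite mulmx_free_eq0.
have [c [c0 unit_c pos_c]] := lex_unit xE0.
exists (c *: (x *m E)); split=> // [j|]; last by rewrite scalemx_sub // submxMl.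
rewrite dotZr dotC; apply/eqP; rewrite mulf_eq0; apply/orP; right; apply/eqP.
have := congr1 (fun r : 'rV[R]_k => r 0 j) xEV; rewrite mulmxA !mxE => <-.
by rewrite /dot !mxE; apply: eq_bigr => i _; rewrite !mxE.
Qed.

Lemma orthonormal_basis m (E : 'M[R]_(m.+1, n)) (v0 : 'rV[R]_n) : row_free E ->
  (v0 <= E)%MS -> dot v0 v0 = 1 -> lexlt 0 v0 ->
  exists2 v : 'I_m.+1 -> 'rV[R]_n, v ord0 = v0 & orthonormal_in E v.
Proof.
move=> freeE v0E v0v0 pos0.
suff gen k : (k <= m)%N -> exists2 v : 'I_k.+1 -> 'rV[R]_n, v ord0 = v0 & orthonormal_in E v.
  exact: gen.
elim: k => [|k IH] km.
  by exists (fun=> v0) => //; split=> // i j; rewrite !ord1 eqxx.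
have [v vv0 on] := IH (ltnW km).
have [w [ww vw wE wpos]] := @orthonormal_extend _ _ k.+1 v freeE km on.
have [orth vE pos] := on.
exists (fun j => if unlift ord_max j is Some i then v i else w).
  by rewrite (_ : ord0 = lift ord_max ord0) ?liftK //; apply: val_inj.
split=> [i j|j|j]; last 2 first.
- by case: unliftP.
- by case: unliftP.
case: (unliftP ord_max i) => [i' ->|->]; case: (unliftP ord_max j) => [j' ->|->].
- by rewrite orth (inj_eq lift_inj).
- by rewrite vw -[LHS]/(false%:R) eq_sym (negPf (neq_lift _ _)).
- by rewrite dotC vw (negPf (neq_lift _ _)).
- by rewrite ww eqxx.
Qed.

(** E = L V with V of rows v, so that the Gram determinant is the square of
det L. *)
Lemma gram_det_gt0 m (E : 'M[R]_(m.+1, n)) (v : 'I_m.+1 -> 'rV[R]_n) : row_free E ->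
  orthonormal_in E v -> 0 < \det (E *m E^T).
Proof.
move=> freeE [orth vE _]; pose V := \matrix_j v j.
have VV : V *m V^T = 1%:M.
  apply/matrixP => i j; rewrite !mxE -orth /dot mxE.
  by apply: eq_bigr => h _; rewrite !mxE.
have rV : \rank V = m.+1.
  apply/eqP; rewrite eqn_leq rank_leq_row /=.
  by rewrite -[X in (X <= _)%N](mxrank1 R) -VV mxrankM_maxl.
have /submxP[L EL] : (E <= V)%MS.
  have VE : (V <= E)%MS by apply/row_subP => j; rewrite rowK.
  by have := mxrank_leqif_sup VE; rewrite rV (eqP freeE) => -[_ <-].
have -> : E *m E^T = L *m L^T by rewrite EL trmx_mul mulmxA -(mulmxA L) VV mulmx1.
rewrite det_mulmx det_tr -expr2 exprn_even_gt0 //=.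
rewrite -unitfE -[_ \is a _]/(L \in unitmx) -row_free_unit /row_free.
rewrite eqn_leq rank_leq_row /= -[X in (X <= _)%N](eqP freeE) EL.
exact: mxrankM_maxl.
Qed.

End Orthonormal.

(** * Forces of a beam on the faces of its simplex *)

Section Beams.
Context {R : realType} {n : nat}.

Lemma det_bordered m (W : 'M[R]_m.+1) (c : 'I_m.+1) (y : R) :
  (forall j, W (lift ord_max j) c = 0) -> W ord_max c = y ->
  (forall i j, W (lift ord_max i) (lift c j) = (i == j)%:R) ->
  \det W = (-1) ^+ (m + c) * y.
Proof.
move=> Wc Wy WI; rewrite (expand_det_col _ c) (bigD1 ord_max) //= big1 ?addr0.
  rewrite Wy mulrC /cofactor; congr (_ * _); rewrite (_ : row' _ _ = 1%:M) ?det1 ?mulr1 //.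
  by apply/matrixP => i j; rewrite !mxE WI.
by move=> i; case: (unliftP ord_max i) => [i' ->|->]; rewrite ?eqxx // Wc mul0r.
Qed.

Section Faces.
Variables (m : nat) (a : vertices R n m.+1).

(** The coordinates of a p - a ord0 on the edges; the coordinates of a vector
tangent to the simplex are the values on it of the differentials of the
barycentric coordinates other than that of a ord0. *)
Definition edge_coord (p : 'I_m.+2) : 'rV[R]_m.+1 := \row_j (p == lift ord0 j)%:R.

Lemma edge_coordE p : edge_coord p *m edges a = a p - a ord0.
Proof.
case: (unliftP ord0 p) => [p' ->|->].
  have -> : edge_coord (lift ord0 p') = delta_mx 0 p'.
    by apply/rowP => j; rewrite !mxE eqxx (inj_eq lift_inj) eq_sym.
  by rewrite -rowE rowK.
have -> : edge_coord ord0 = 0 by apply/rowP => j; rewrite !mxE (negPf (neq_lift _ _)).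
by rewrite mul0mx subrr.
Qed.

Lemma edge_coordB p q : (edge_coord p - edge_coord q) *m edges a = a p - a q.
Proof. by rewrite mulmxBl !edge_coordE opprB addrA subrK. Qed.

Lemma insub_lift (q : 'I_m) : insub (val (lift (@ord_max m) q)) = Some q :> option 'I_m.
Proof. by rewrite -[val _]/(nat_of_ord _) lift_max; exact: valK. Qed.

Lemma insub_max : insub (val (@ord_max m)) = None :> option 'I_m.
Proof. by rewrite insubN // ltnn. Qed.

(** The rows whose exterior product is paired with the simplex in the interior
multiplication, in coordinates on the edges: the edges of the face opposite
a i, followed by the vector of coordinates x. *)
Definition face_mx (i : 'I_m.+2) (x : 'rV[R]_m.+1) : 'M[R]_m.+1 :=
  \matrix_(p < m.+1) (if insub (val p) is Some q then
    edge_coord (inord (bump i (lift ord0 (q : 'I_m)))) - edge_coord (inord (bump i 0)) else x).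

Lemma face_mxE i x : face_mx i x *m edges a =
  wedge_last (k := m.+1) (edges (face a i)) (x *m edges a).
Proof.
apply/row_matrixP => p; rewrite row_mul !rowK.
case: insubP => [q _ _|//]; rewrite mulmxBl !edge_coordE rowK /face.
by rewrite opprB addrA subrK.
Qed.

Lemma face_mx_max i x j : face_mx i x ord_max j = x 0 j.
Proof. by rewrite mxE insub_max. Qed.

Lemma face_mx_lift i x q j : face_mx i x (lift ord_max q) j =
  (inord (bump i (lift ord0 q)) == lift ord0 j :> 'I_m.+2)%:R -
  (inord (bump i 0) == lift ord0 j :> 'I_m.+2)%:R.
Proof. by rewrite mxE insub_lift !mxE. Qed.

(** On the right is, up to sign, the change of the i-th barycentric coordinate
along the edge from a q to a p.  For i > 0 the edges of the face start at
a ord0, and omit one coordinate.  For i = 0 they start at a 1, and the column of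
the sums of coordinates plays the role of the omitted one: it is obtained by a
unipotent column operation C. *)
Lemma det_face_mx (i p q : 'I_m.+2) :
  (-1) ^+ i * \det (face_mx i (edge_coord p - edge_coord q)) =
  (-1) ^+ m.+1 * ((p == i)%:R - (q == i)%:R).
Proof.
set x := edge_coord p - edge_coord q.
case: (unliftP ord0 i) => [i' ->|->].
  have b0 : inord (bump (lift ord0 i') 0) = ord0 :> 'I_m.+2.
    by apply: val_inj; rewrite /= inordK.
  have bq (q' : 'I_m) :
      inord (bump (lift ord0 i') (lift ord0 q')) = lift ord0 (lift i' q') :> 'I_m.+2.
    have lt_q := ltn_ord q'.
    by apply: val_inj; rewrite /= inordK /bump; lia.
  rewrite (@det_bordered _ _ i' (x 0 i')) ?face_mx_max //; last 2 first.
  - move=> j; rewrite face_mx_lift b0 bq (inj_eq lift_inj) [_ == i']eq_sym.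
    by rewrite !(negPf (neq_lift _ _)) subrr.
  - move=> j h; rewrite face_mx_lift b0 bq !(inj_eq lift_inj).
    by rewrite (negPf (neq_lift _ _)) subr0.
  rewrite mulrA -exprD /x !mxE; congr (_ * _).
  by rewrite /= /bump add1n addSn -signr_odd -[RHS]signr_odd /= !oddD; case: odd; case: odd.
pose C : 'M[R]_m.+1 := \matrix_(h, j) ((h == j) || (j == ord0))%:R.
have detC : \det C = 1.
  rewrite det_trig; first by rewrite big1 // => h _; rewrite mxE eqxx.
  apply/is_trig_mxP => h j hj; rewrite mxE -val_eqE /= ltn_eqF // -val_eqE /=.
  by rewrite (gtn_eqF (leq_ltn_trans _ hj)).
rewrite expr0 mul1r (_ : \det _ = \det (face_mx ord0 x *m C)); last first.
  by rewrite det_mulmx detC mulr1.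
have WC0 h : (face_mx ord0 x *m C) h ord0 = \sum_j face_mx ord0 x h j.
  by rewrite mxE; apply: eq_bigr => j _; rewrite !mxE eqxx orbT mulr1.
have WCS h j : (face_mx ord0 x *m C) h (lift ord0 j) = face_mx ord0 x h (lift ord0 j).
  rewrite mxE (bigD1 (lift ord0 j)) //= [C _ _]mxE eqxx mulr1 big1 ?addr0 // => h' h'j.
  by rewrite [C _ _]mxE (negPf h'j) [_ == ord0]eq_sym (negPf (neq_lift _ _)) mulr0.
have sum_coord (u : 'I_m.+2) : \sum_j (u == lift ord0 j)%:R = (u != ord0)%:R :> R.
  case: (unliftP ord0 u) => [u' ->|->]; last first.
    by rewrite eqxx big1 // => j _; rewrite (negPf (neq_lift _ _)).
  rewrite eq_sym neq_lift (bigD1 u') //= eqxx big1 ?addr0 // => j ju.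
  by rewrite (inj_eq lift_inj) eq_sym (negPf ju).
have b0 : inord (bump (@ord0 m.+1) 0) = lift ord0 ord0 :> 'I_m.+2.
  by apply: val_inj; rewrite /= inordK.
have bq (q' : 'I_m) :
    inord (bump (@ord0 m.+1) (lift ord0 q')) = lift ord0 (lift ord0 q') :> 'I_m.+2.
  have lt_q := ltn_ord q'.
  by apply: val_inj; rewrite /= inordK /bump; lia.
rewrite (@det_bordered _ (face_mx ord0 x *m C) ord0 (\sum_j x 0 j)).
- rewrite addn0 [(-1) ^+ m.+1]exprS mulN1r mulNr -mulrN; congr (_ * _).
  under eq_bigr do rewrite /x !mxE.
  rewrite sumrB !sum_coord opprB.
  by case: eqP; case: eqP => _ _ /=; rewrite ?subrr ?subr0 ?sub0r.
- move=> h; rewrite WC0; under eq_bigr do rewrite face_mx_lift b0 bq.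
  by rewrite sumrB !sum_coord subrr.
- by rewrite WC0; apply: eq_bigr => j _; rewrite face_mx_max.
- move=> h j; rewrite WCS face_mx_lift b0 bq !(inj_eq lift_inj).
  by rewrite (negPf (neq_lift _ _)) subr0.
Qed.

Lemma interior_mul_edge (i p q : 'I_m.+2) :
  (-1) ^+ i * dot (interior_mul (edges a) (edges (face a i))) (a p - a q) =
  (-1) ^+ m.+1 * \det (edges a *m (edges a)^T) * ((p == i)%:R - (q == i)%:R).
Proof.
rewrite -edge_coordB dotC (dot_interior_mul (k := m.+1)) // -face_mxE /pairing.
by rewrite -mulmxA det_mulmx mulrA det_face_mx mulrAC.
Qed.

End Faces.
End Beams.

(** * Simplices and lists of vertices *)

Section SimplicesOfSequences.
Context {R : realType} {n : nat}.
Implicit Types (s t u : seq 'rV[R]_n).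

Definition vert d s : vertices R n d := fun i => nth 0 s i.
Arguments vert : clear implicits.

Lemma codom_vert d s : size s = d.+1 -> codom (vert d s) = s.
Proof.
move=> sz; rewrite /codom /image_mem /vert.
by rewrite (map_comp (nth 0 s) val) val_enum_ord -sz -/(mkseq _ _) mkseq_nth.
Qed.

Lemma hull_perm d (a b : vertices R n d) : perm_eq (codom a) (codom b) -> hull a = hull b.
Proof.
suff sub (a' b' : vertices R n d) : perm_eq (codom a') (codom b') -> hull a' `<=` hull b'.
  by move=> ab; apply/seteqP; split; apply: sub; rewrite // perm_sym.
have -> : codom b' = [tuple b' i | i < d.+1] by [].
move=> /tuple_permP[pi a'E] x [w [w0 w1 ->]].
have {}a'E i : a' i = b' (pi i).
  have : nth 0 (codom a') i = nth 0 [tuple b' (pi i) | i < d.+1] i.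
    rewrite a'E; congr nth; congr (tval _).
    by apply/eq_from_tnth => h; rewrite !tnth_mktuple.
  by rewrite -tnth_nth tnth_mktuple => <-; rewrite (nth_map i) ?size_enum_ord // nth_ord_enum.
exists (fun j => w (pi^-1 j)%g); split=> [j|//|]; first exact: w0.
  by rewrite -w1 (reindex_inj (@perm_inj _ pi)); apply: eq_bigr => i _; rewrite permK.
rewrite [RHS](reindex_inj (@perm_inj _ pi)); apply: eq_bigr => i _.
by rewrite permK a'E.
Qed.

Lemma indep_codom d (a : vertices R n d) : indep (codom a) <-> is_simplex a.
Proof.
have -> : indep (codom a) = free [tuple homog (a i) | i < d.+1].
  by rewrite /indep /codom /image_mem -map_comp.
have E (c : 'I_d.+1 -> R) : \sum_(i < d.+1) c i *: [tuple homog (a i) | i < d.+1]`_i =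
    row_mx (\sum_i c i)%:M (\sum_i c i *: a i).
  rewrite -homog_lincomb; apply: eq_bigr => i _.
  by rewrite -tnth_nth tnth_mktuple.
split=> [/freeP ind c c0 ca|simp].
  by apply: ind; rewrite E c0 ca raddf0 row_mx0.
apply/freeP => c; rewrite E -[RHS]row_mx0 => /eq_row_mx[c0 ca]; apply: simp => //.
by move/matrixP/(_ 0 0): c0; rewrite !mxE eqxx.
Qed.

Lemma face_lift m (a : vertices R n m.+1) i j : face a i j = a (lift i j).
Proof.
congr a; apply: val_inj; rewrite /= inordK //.
by have := ltn_ord (lift i j).
Qed.

Lemma perm_face m (a : vertices R n m.+1) i :
  perm_eq (a i :: codom (face a i)) (codom a).
Proof.
have -> : codom (face a i) = [seq a j | j <- map (lift i) (enum 'I_m.+1)].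
  by rewrite -map_comp; apply: eq_map => j /=; rewrite face_lift.
rewrite -map_cons; apply: perm_map; apply: uniq_perm; rewrite ?enum_uniq //=.
  rewrite map_inj_uniq ?enum_uniq ?andbT; last exact: lift_inj.
  by apply/mapP => -[j _ /eqP]; rewrite (negPf (neq_lift _ _)).
move=> j; rewrite mem_enum inE; case: (unliftP i j) => [j' ->|->]; last by rewrite eqxx.
by rewrite map_f ?orbT // mem_enum.
Qed.

Lemma edges_free d (a : vertices R n d) : is_simplex a -> row_free (edges a).
Proof.
move=> simp; apply: inj_row_free => x xE.
pose c i := if unlift ord0 i is Some j then x 0 j else - \sum_j x 0 j.
have c0 : c ord0 = - \sum_j x 0 j by rewrite /c unlift_none.
have cS j : c (lift ord0 j) = x 0 j by rewrite /c liftK.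
apply/rowP => j; rewrite mxE -cS; apply: simp.
  by rewrite big_ord_recl c0 (eq_bigr _ (fun j _ => cS j)) addNr.
rewrite -[RHS]xE mulmx_sum_row big_ord_recl c0 scaleNr scaler_suml addrC.
under [RHS]eq_bigr do rewrite rowK scalerBr.
by rewrite sumrB; congr (_ - _); apply: eq_bigr => i _; rewrite cS.
Qed.

End SimplicesOfSequences.

Arguments vert {R n} d s.

(** * Sums of beams *)

Section BeamSystems.
Context {R : realType} {n : nat}.
Implicit Types (s t u : seq 'rV[R]_n) (a b : 'rV[R]_n).

Definition load d s F : set 'rV[R]_n -> 'rV[R]_n :=
  fun B => hausdorff_on (vert d s) B *: F.

Record stressed_simplex k := StressedSimplex {
  carrier : vertices R n k;
  stress : 'M[R]_n;
  principal_stress : 'I_k -> R;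
  principal_axis : 'I_k -> 'rV[R]_n }.

Definition beam_of k (b : stressed_simplex k) :=
  beam (carrier b) (principal_stress b) (principal_axis b).

Definition admissible k (b : stressed_simplex k) : Prop :=
  [/\ is_simplex (carrier b) /\ lex_ordered (carrier b),
      (stress b)^T = stress b,
      forall lambda : R, lambda != 0 ->
        (eigenspace (stress b) lambda <= edges (carrier b))%MS &
      stress_decomposition (carrier b) (stress b) (principal_stress b) (principal_axis b)].

Lemma stress_admissible k (sigma : vertices R n k) mu v :
  is_simplex sigma -> lex_ordered sigma -> orthonormal_in (edges sigma) v ->
  admissible (StressedSimplex sigma (\sum_j mu j *: tensor (v j) (v j)) mu v).
Proof.
move=> simp lex [orth vE pos]; split=> //=.
  rewrite raddf_sum; apply: eq_bigr => j _ /=.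
  by rewrite linearZ /= /tensor trmx_mul trmxK.
move=> lambda l0; apply/rV_subP => x /eigenspaceP xA.
have -> : x = lambda^-1 *: (lambda *: x) by rewrite scalerA mulVf // scale1r.
rewrite scalemx_sub // -xA mulmx_sumr summx_sub // => j _.
by rewrite -scalemxAr scalemx_sub // /tensor mulmxA mulmx_sub.
Qed.

Definition reversed k (b : stressed_simplex k) :=
  StressedSimplex (carrier b) (- stress b) (fun j => - principal_stress b j)
    (principal_axis b).

Lemma eigenspaceN (A : 'M[R]_n) (lambda : R) :
  (eigenspace (- A) lambda <= eigenspace A (- lambda))%MS.
Proof.
apply/rV_subP => x /eigenspaceP xA; apply/eigenspaceP.
by rewrite scaleNr -xA mulmxN opprK.
Qed.

Lemma reversed_admissible k (b : stressed_simplex k) : admissible b -> admissible (reversed b).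
Proof.
move=> [simp sym eig [orth vE pos dec]]; split=> //=; first by rewrite raddfN /= sym.
  move=> lambda l0; apply: submx_trans (eigenspaceN _ _) (eig _ _).
  by rewrite oppr_eq0.
split=> //; rewrite dec -sumrN; apply: eq_bigr => j _.
by rewrite scaleNr.
Qed.

Lemma beam_reversed k (b : stressed_simplex k) B : beam_of (reversed b) B = - beam_of b B.
Proof.
rewrite /beam_of /beam /force_system -sumrN; apply: eq_bigr => i _.
rewrite -scalerN; congr (_ *: _); rewrite /beam_force -!scalerN -sumrN.
by congr (_ *: (_ *: _)); apply: eq_bigr => j _; rewrite mulNr scaleNr.
Qed.

(** The stress has a single nonzero eigenvalue, for a unit multiple kappa (b - a)
of the edge; that axis is completed to an orthonormal basis, and the eigenvalue
is adjusted to the volume, to kappa and to the Gram determinant G.  The vertices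
have to be sorted, so a and b become the vertices q and p. *)
Lemma beam_two_faces m a b t c : indep [:: a, b & t] -> size t = m ->
  exists2 x : stressed_simplex m.+1, admissible x &
    beam_of x = load m (a :: t) (c *: (b - a)) - load m (b :: t) (c *: (b - a)).
Proof.
move=> ind szt.
have u_abt : uniq [:: a, b & t].
  by have := free_uniq ind; rewrite map_inj_uniq //; exact: homog_inj.
have [u abt_u lex_u] := lex_sort u_abt.
have szu : size u = m.+2 by rewrite -(perm_size abt_u) /= szt.
pose sigma := vert m.+1 u.
have sigma_u : codom sigma = u by exact: codom_vert.
have simp : is_simplex sigma.
  by apply/indep_codom; rewrite sigma_u -(indep_perm abt_u).
have lex : lex_ordered sigma.
  by move=> i j ij; apply: lex_u; rewrite szu ltn_ord andbT.
have vertex x : x \in [:: a; b] -> exists i, sigma i = x.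
  move=> x_ab; have : x \in codom sigma.
    rewrite sigma_u -(perm_mem abt_u) !inE.
    by move: x_ab; rewrite !inE orbA => ->.
  by case/codomP => i ->; exists i.
have [q qa] : exists q, sigma q = a by apply: vertex; rewrite mem_head.
have [p pb] : exists p, sigma p = b by apply: vertex; rewrite !inE eqxx orbT.
have ab : a != b by move: u_abt; rewrite /= inE negb_or => /andP[/andP[]].
have qp : q != p by apply: contra ab => /eqP qp; rewrite -qa -pb qp.
have facep : perm_eq (codom (face sigma p)) (a :: t).
  rewrite -(perm_cons b) -{1}pb (perm_trans (perm_face sigma p)) // sigma_u perm_sym.
  by rewrite (perm_trans _ abt_u) // (perm_catCA [:: b] [:: a]).
have faceq : perm_eq (codom (face sigma q)) (b :: t).
  rewrite -(perm_cons a) -{1}qa (perm_trans (perm_face sigma q)) // sigma_u perm_sym.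
  exact: abt_u.
have ba0 : b - a != 0 by rewrite subr_eq0 eq_sym.
have [kappa [k0 unit_ba pos_ba]] := lex_unit ba0.
have freeE := edges_free simp.
have baE : (kappa *: (b - a) <= edges sigma)%MS.
  rewrite scalemx_sub // -qa -pb -edge_coordB.
  exact: submxMl.
have [v v0 on] := orthonormal_basis freeE baE unit_ba pos_ba.
pose G := \det (edges sigma *m (edges sigma)^T).
have G0 : 0 < G by exact: gram_det_gt0 on.
have vol0 : vol sigma != 0 by rewrite gt_eqF // sqrtr_gt0.
pose mu0 := c * vol sigma / (kappa ^+ 2 * ((-1) ^+ m.+1 * G)).
pose mu (j : 'I_m.+1) := if j == ord0 then mu0 else 0.
exists (StressedSimplex sigma (\sum_j mu j *: tensor (v j) (v j)) mu v).
  exact: stress_admissible.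
have force i : beam_force sigma mu v i = ((p == i)%:R - (q == i)%:R) *: (c *: (b - a)).
  rewrite /beam_force (bigD1 ord0) //= big1 ?addr0; last first.
    by move=> j j0; rewrite /mu (negPf j0) mul0r scale0r.
  rewrite /mu eqxx v0 dotZr !scalerA; congr (_ *: _).
  have := interior_mul_edge sigma i p q; rewrite pb qa -/G.
  set D := dot _ _; set d := _ - _ => E.
  have -> : (vol sigma)^-1 * (-1) ^+ i * (mu0 * (kappa * D) * kappa) =
    (vol sigma)^-1 * (mu0 * (kappa ^+ 2 * ((-1) ^+ i * D))) by ring.
  rewrite E /mu0; have : (-1) ^+ m.+1 != 0 :> R by rewrite signr_eq0.
  move: ((-1) ^+ m.+1) => sg sg0.
  by field; rewrite vol0 k0 sg0 gt_eqF.
apply/funext => B; rewrite /beam_of /beam /force_system /=.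
have -> : (load m (a :: t) (c *: (b - a)) - load m (b :: t) (c *: (b - a))) B =
    load m (a :: t) (c *: (b - a)) B - load m (b :: t) (c *: (b - a)) B by [].
under eq_bigr do rewrite force.
rewrite (bigD1 p) //= (bigD1 q) //= big1 ?addr0 => [|i /andP[ip iq]]; last first.
  by rewrite ![_ == i]eq_sym (negPf ip) (negPf iq) subrr scale0r scaler0.
have hausd x (i : 'I_m.+2) : perm_eq (codom (face sigma i)) (x :: t) ->
    hausdorff_on (face sigma i) B = hausdorff_on (vert m (x :: t)) B.
  by move=> px; rewrite /hausdorff_on (hull_perm (b := vert m (x :: t))) // codom_vert //= szt.
rewrite /load -(hausd _ _ facep) -(hausd _ _ faceq) !eqxx [p == q]eq_sym (negPf qp).
by rewrite subr0 sub0r scale1r scaleN1r scalerN.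
Qed.

End BeamSystems.

Section Quotient.
Context {R : realType} {n : nat} (m : nat).

(** Beams are indexed by arbitrary finite types, so that two sums are added by
taking a disjoint union. *)
Definition beam_sum (G : set 'rV[R]_n -> 'rV[R]_n) : Prop :=
  exists (I : finType) (x : I -> @stressed_simplex R n m.+1),
    (forall i, admissible (x i)) /\ G = \sum_i beam_of (x i).

Definition beam_sums : {pred set 'rV[R]_n -> 'rV[R]_n} := fun G => `[< beam_sum G >].

Fact beam_sums_closed : zmod_closed beam_sums.
Proof.
split=> [|G H /asboolP[I [x [x_ok ->]]] /asboolP[J [y [y_ok ->]]]]; apply/asboolP.
  exists void, (fun i : void => match i with end); split; first by case.
  by rewrite big1 //; case.
exists (I + J)%type, (fun h => match h with inl i => x i | inr j => reversed (y j) end).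
split=> [[i|j] //|]; first exact: reversed_admissible.
rewrite big_sumType /= -sumrN; congr (_ + _); apply: eq_bigr => j _.
by apply/funext => B; rewrite beam_reversed.
Qed.

HB.instance Definition _ := GRing.isZmodClosed.Build (set 'rV[R]_n -> 'rV[R]_n)
  beam_sums beam_sums_closed.

Definition load_class := Quotient.quot beam_sums.

Definition class_of_load (s : seq 'rV[R]_n) (F : 'rV[R]_n) : load_class :=
  \pi_load_class%qT (load m s F).

Fact class_of_load_additive s : zmod_morphism (class_of_load s).
Proof.
move=> F G; rewrite /class_of_load -raddfB; congr (\pi_ _ _)%qT.
by apply/funext => B; rewrite /load scalerBr.
Qed.

HB.instance Definition _ s := GRing.isZmodMorphism.Build 'rV[R]_n load_class
  (class_of_load s) (class_of_load_additive s).

Lemma perm_load (s t : seq 'rV[R]_n) (F : 'rV[R]_n) :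
  size s = m.+1 -> perm_eq s t -> load m s F = load m t F.
Proof.
move=> szs st; apply/funext => B; rewrite /load /hausdorff_on.
by rewrite (hull_perm (b := vert m t)) // !codom_vert // -(perm_size st).
Qed.

End Quotient.

(** The quotient of all set functions by the sums of beams is a group in which
loads satisfy the sliding rule.  Lists of the wrong length do not represent
simplices, and get the class 0. *)
Theorem equilibrium_beam_sum (R : realType) (n m : nat) (I : finType)
    (F : I -> 'rV[R]_n) (s : I -> seq 'rV[R]_n) : (m < n)%N ->
  (forall i, indep (s i)) -> (forall i, size (s i) = m.+1) -> \sum_i F i = 0 ->
  (\sum_i (\sum_(p <- s i) p)^T *m F i)^T = \sum_i (\sum_(p <- s i) p)^T *m F i ->
  beam_sum m (\sum_i load m (s i) (F i)).
Proof.
move=> mn ind sz F0 torque.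
pose f (s : seq 'rV[R]_n) : {additive 'rV[R]_n -> load_class m} :=
  if size s == m.+1 then (class_of_load m s : {additive _ -> _})
  else (\0 : {additive _ -> _}).
have f_perm s1 s2 : perm_eq s1 s2 -> f s1 =1 f s2.
  move=> p F1; rewrite /f -(perm_size p); case: eqP => // sz1.
  by rewrite /= /class_of_load (perm_load _ sz1 p).
have f_beam a b t (l : R) : indep [:: a, b & t] -> size t = m ->
    f (a :: t) (l *: (b - a)) = f (b :: t) (l *: (b - a)).
  move=> abt szt; rewrite /f /= szt eqxx; apply/eqmodP.
  have [x x_ok xE] := beam_two_faces l abt szt.
  rewrite /= /Quotient.equiv -xE; apply/asboolP.
  by exists unit, (fun=> x); split=> //; rewrite big_const card_unit /= addr0.
have /eqP := balanced_sum_eq0 mn f_perm f_beam ind sz F0 torque.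
have -> : \sum_i f (s i) (F i) = \pi_(load_class m)%qT (\sum_i load m (s i) (F i)).
  by rewrite raddf_sum; apply: eq_bigr => i _; rewrite /f sz eqxx.
rewrite -[X in _ == X](raddf0 \pi_(load_class m)%qT) -Quotient.idealrBE subr0.
by move/asboolP.
Qed.

Theorem theorem3p1 (R : realType) (k n : nat) (hk : (1 <= k)%N)
    (hn : (k + 1 <= n)%N) (l : nat) (F : 'I_l -> 'rV[R]_n)
    (s : 'I_l -> vertices R n k.-1)
    (hs : forall i, is_simplex (s i))
    (hforce : \sum_(i < l) F i = 0)
    (htorque : \sum_(i < l) wedge2 (F i) (barycenter (s i)) = 0) :
  exists (N : nat) (sigma : 'I_N -> vertices R n k) (A : 'I_N -> 'M[R]_n)
      (mu : 'I_N -> 'I_k -> R) (v : 'I_N -> 'I_k -> 'rV[R]_n),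
    (forall j : 'I_N,
      [/\ is_simplex (sigma j) /\ lex_ordered (sigma j),
          (A j)^T = A j,
          forall lambda : R, lambda != 0 ->
            (eigenspace (A j) lambda <= edges (sigma j))%MS &
          stress_decomposition (sigma j) (A j) (mu j) (v j)]) /\
    (forall B : set 'rV[R]_n, borel B ->
      force_system F s B = \sum_(j < N) beam (sigma j) (mu j) (v j) B).
Proof.
case: k hk hn s hs htorque => // m _ hn s hs htorque.
have szs i : size (codom (s i)) = m.+1 by rewrite size_codom card_ord.
have torque : (\sum_i (\sum_(p <- codom (s i)) p)^T *m F i)^T =
    \sum_i (\sum_(p <- codom (s i)) p)^T *m F i.
  have sumE i : \sum_(p <- codom (s i)) p = m.+1%:R *: barycenter (s i).
    by rewrite /barycenter scalerA mulfV ?pnatr_eq0 // scale1r big_image.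
  apply/eqP; rewrite -subr_eq0 raddf_sum -sumrB /=; apply/eqP.
  transitivity (m.+1%:R *: \sum_i wedge2 (F i) (barycenter (s i))); last first.
    by rewrite htorque scaler0.
  rewrite scaler_sumr; apply: eq_bigr => i _.
  rewrite sumE trmx_mul trmxK /wedge2 /tensor [(_ *: _)^T]linearZ /=.
  by rewrite -scalemxAl -scalemxAr -scalerBr.
have mn : (m < n)%N by rewrite ltnW // -addn1.
have [|I [x [x_ok xE]]] := equilibrium_beam_sum mn _ szs hforce torque.
  by move=> i; apply/indep_codom; apply: hs.
pose y (j : 'I_#|I|) := x (enum_val j).
exists #|I|, (fun j => carrier (y j)), (fun j => stress (y j)),
  (fun j => principal_stress (y j)), (fun j => principal_axis (y j)).
split=> [j|B _]; first exact: x_ok.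
have sumE (J : finType) (g : J -> set 'rV[R]_n -> 'rV[R]_n) : (\sum_j g j) B = \sum_j g j B.
  by rewrite fct_sumE.
transitivity ((\sum_i load m (codom (s i)) (F i)) B).
  rewrite sumE; apply: eq_bigr => i _; rewrite /load /hausdorff_on.
  by rewrite (hull_perm (b := s i)) // codom_vert.
by rewrite xE sumE [LHS](reindex _ (onW_bij _ (enum_val_bij I))).
Qed.
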